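(* Let $n$ be a positive integer with $n\equiv 4\pmod 6$ and $n>2$, and let $H$ be a finite abelian group of order $n^2+n+1$ with identity $e$. Then there are no inverse-closed subsets $T_0,T_1\subseteq H$ with $e\in T_0$ and $|T_0|+|T_1|=2n+1$ satisfying in $\mathbb{Z}[H]$ $$T_0T_1=H-e\quad\text{and}\quad T_0^2+T_1^2=2H-T_0^{(2)}-T_1^{(2)}+2n\,e.$$
   Context: $\mathbb{Z}[H]$ is the group ring of $H$ over $\mathbb{Z}$; a subset $D\subseteq H$ is identified with $\sum_{d\in D}d$, and $H$ also denotes $\sum_{h\in H}h$. For $A=\sum a_h h$ and $t\in\mathbb{Z}$, $A^{(t)}=\sum a_h h^t$. A subset $D$ is inverse-closed if $D^{(-1)}=D$. *)

(* Defs.v *)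
From HB Require Import structures.
From mathcomp Require Import all_boot all_order all_algebra all_fingroup.

Set Implicit Arguments.
Unset Strict Implicit.
Unset Printing Implicit Defensive.

Import GRing.Theory.
Local Open Scope ring_scope.

(* The integral group ring Z[H]: coefficient functions H -> int with pointwise
   addition and convolution product. It is an alias of {ffun H -> int} because
   the latter already carries the pointwise product. *)
Definition groupring (H : finGroupType) : Type := {ffun H -> int}.

HB.instance Definition _ (H : finGroupType) :=
  GRing.Zmodule.copy (groupring H) {ffun H -> int}.

Section GroupRing.
Variable H : finGroupType.
Implicit Types (A B C : groupring H) (D : {set H}) (g h x : H) (t : int).

Definition gcoef A h : int := (A : {ffun H -> int}) h.

Definition gelt h : groupring H := [ffun x => (x == h)%:R].

Definition gmul A B : groupring H :=
  [ffun x => \sum_(h : H) gcoef A h * gcoef B (h^-1 * x)%g].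

Lemma groupringP A B : (forall h, gcoef A h = gcoef B h) -> A = B.
Proof. by move=> eqAB; apply/ffunP. Qed.

Lemma gcoefD A B h : gcoef (A + B) h = gcoef A h + gcoef B h.
Proof. exact: ffunE. Qed.

Lemma gcoefN A h : gcoef (- A) h = - gcoef A h.
Proof. exact: ffunE. Qed.

Lemma gcoef0 h : gcoef 0 h = 0.
Proof. exact: ffunE. Qed.

Lemma gcoef_sum (I : Type) (r : seq I) (P : pred I) (F : I -> groupring H) h :
  gcoef (\sum_(i <- r | P i) F i) h = \sum_(i <- r | P i) gcoef (F i) h.
Proof.
by apply: (big_morph (gcoef^~ h)) => [A B|]; rewrite ?gcoefD ?gcoef0.
Qed.

Lemma gcoef_elt g h : gcoef (gelt g) h = (h == g)%:R.
Proof. exact: ffunE. Qed.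

Lemma gcoef_mul A B x :
  gcoef (gmul A B) x = \sum_(h : H) gcoef A h * gcoef B (h^-1 * x)%g.
Proof. exact: ffunE. Qed.

Fact gmulA : associative gmul.
Proof.
move=> A B C; apply: groupringP => x; rewrite !gcoef_mul.
under eq_bigr do rewrite gcoef_mul mulr_sumr.
under [RHS]eq_bigr do rewrite gcoef_mul mulr_suml.
rewrite [RHS]exchange_big /=; apply: eq_bigr => h _.
rewrite [RHS](reindex_inj (mulgI h)) /=; apply: eq_bigr => k _.
by rewrite mulrA mulKg invMg mulgA.
Qed.

Fact gmul1l : left_id (gelt 1%g) gmul.
Proof.
move=> A; apply: groupringP => x; rewrite gcoef_mul (bigD1 1%g) //= big1.
  by rewrite gcoef_elt eqxx mul1r invg1 mul1g addr0.
by move=> h /negPf nh; rewrite gcoef_elt nh mul0r.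
Qed.

Fact gmul1r : right_id (gelt 1%g) gmul.
Proof.
move=> A; apply: groupringP => x; rewrite gcoef_mul (bigD1 x) //= big1.
  by rewrite gcoef_elt mulVg eqxx mulr1 addr0.
move=> h nh; rewrite gcoef_elt; case: eqP => [e|_]; last by rewrite mulr0.
by case/eqP: nh; apply/(mulgI h^-1%g); rewrite mulVg e.
Qed.

Fact gmulDl : left_distributive gmul +%R.
Proof.
move=> A B C; apply: groupringP => x.
rewrite gcoefD !gcoef_mul -big_split /=.
by apply: eq_bigr => h _; rewrite gcoefD mulrDl.
Qed.

Fact gmulDr : right_distributive gmul +%R.
Proof.
move=> A B C; apply: groupringP => x.
rewrite gcoefD !gcoef_mul -big_split /=.
by apply: eq_bigr => h _; rewrite gcoefD mulrDr.
Qed.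

Fact gone_neq0 : gelt 1%g != 0 :> groupring H.
Proof.
apply/eqP => /(congr1 (gcoef^~ 1%g)).
by rewrite gcoef_elt gcoef0 eqxx.
Qed.

HB.instance Definition _ := GRing.Zmodule_isNzRing.Build (groupring H)
  gmulA gmul1l gmul1r gmulDl gmulDr gone_neq0.

Lemma geltM g h : gelt g * gelt h = gelt (g * h)%g.
Proof.
apply: groupringP => x; rewrite gcoef_mul (bigD1 g) //= big1.
  by rewrite !gcoef_elt eqxx mul1r addr0 -(inj_eq (mulgI g)) mulKVg.
by move=> k /negPf nk; rewrite gcoef_elt nk mul0r.
Qed.

Definition gset D : groupring H := \sum_(d in D) gelt d.

Lemma gcoef_set D h : gcoef (gset D) h = (h \in D)%:R.
Proof.
rewrite gcoef_sum; under eq_bigr do rewrite gcoef_elt.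
case: (boolP (h \in D)) => hD; last first.
  by rewrite big1 // => d dD; case: eqP hD => // ->; rewrite dD.
rewrite (bigD1 h) //= eqxx big1 ?addr0 // => d /andP[_ ndh].
by rewrite eq_sym (negPf ndh).
Qed.

Definition expgz h t : H :=
  match t with Posz m => (h ^+ m)%g | Negz m => (h ^- m.+1)%g end.

(* A^(t) : h |-> h^t need not be injective, so coefficients are added up. *)
Definition gpower t A : groupring H :=
  \sum_(h : H) gelt (expgz h t) *~ gcoef A h.

Definition inverse_closed D : Prop := gpower (-1) (gset D) = gset D.

End GroupRing.

Notation "D %:GR" := (gset D) (at level 2, left associativity, format "D %:GR")
  : ring_scope.
Notation "A ^( t )" := (gpower t A) (at level 2, format "A ^( t )")
  : ring_scope.

(* Main.v *)
(** Since [n = 1 %[mod 3]], 3 divides [#|H|], so [H] has a character chi of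
    order 3.  On an inverse-closed set chi takes an integer value which equals
    its value on [T^(2)], because squaring and inversion agree on cube roots of
    unity.  Writing a and b for the values on [T0] and [T1], the two equations
    give [a * b = -1] and [a ^ 2 + b ^ 2 = 2 n - a - b], which force [n = 1]. *)
Require Import Defs.
From HB Require Import structures.
From mathcomp Require Import all_boot all_order all_algebra all_fingroup.
From mathcomp Require Import all_solvable all_field all_character.
From mathcomp Require Import zify ring.

Import GRing.Theory Num.Theory.
Local Open Scope ring_scope.

Section CharEval.
Variables (H : finGroupType) (R : comNzRingType) (f : H -> R).
Implicit Types (A B : groupring H) (D : {set H}).

(** The linear extension of [f] to the group ring, a ring morphism when [f] is a character. *)
Definition char_eval A : R := \sum_h (gcoef A h)%:~R * f h.

Fact char_eval_is_additive : zmod_morphism char_eval.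
Proof.
move=> A B; rewrite /char_eval -sumrB; apply: eq_bigr => h _.
by rewrite gcoefD gcoefN intrB mulrBl.
Qed.

HB.instance Definition _ :=
  GRing.isZmodMorphism.Build (groupring H) R char_eval char_eval_is_additive.

Lemma char_eval_elt h : char_eval (gelt h) = f h.
Proof.
rewrite /char_eval (bigD1 h) //= big1 => [|k /negPf nk].
  by rewrite gcoef_elt eqxx mul1r addr0.
by rewrite gcoef_elt nk mul0r.
Qed.

Lemma char_eval_set D : char_eval D%:GR = \sum_(d in D) f d.
Proof. by rewrite raddf_sum; apply: eq_bigr => d _; apply: char_eval_elt. Qed.

Lemma char_eval_power t D :
  char_eval D%:GR^(t) = \sum_(d in D) f (expgz d t).
Proof.
rewrite /gpower raddf_sum [RHS]big_mkcond /=; apply: eq_bigr => h _.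
by rewrite raddfMz /= char_eval_elt gcoef_set; case: (h \in D).
Qed.

Hypothesis fM : {morph f : x y / (x * y)%g >-> x * y}.

Lemma char_evalM : {morph char_eval : A B / A * B}.
Proof.
move=> A B; rewrite /char_eval mulr_suml.
under eq_bigr do rewrite gcoef_mul rmorph_sum /= mulr_suml.
rewrite exchange_big /=; apply: eq_bigr => h _.
(* Substituting [h * k] for the outer variable separates the convolution into a product of two
   sums. *)
rewrite (reindex_inj (mulgI h)) /= mulr_sumr; apply: eq_bigr => k _.
by rewrite mulKg fM intrM mulrACA.
Qed.

End CharEval.

Arguments char_eval {H R} f A.

(** Translation by an [h] with [xi h != 1] permutes the summands, yet multiplies the sum by
    [xi h]. *)
Lemma sum_linear_char (H : finGroupType) (xi : 'CF([set: H])) :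
  xi \is a linear_char -> xi != 1 -> \sum_h xi h = 0.
Proof.
move=> Lxi xi_neq1.
have [h xih] : exists h, xi h != 1.
  apply/existsP; apply: contraNT xi_neq1; rewrite negb_exists => /forallP xi1.
  apply/eqP/cfunP => h; rewrite cfun1E inE.
  by apply/eqP; have := xi1 h; rewrite negbK.
have: xi h * \sum_k xi k = \sum_k xi k.
  rewrite [RHS](reindex_inj (mulgI h)) /= mulr_sumr.
  by apply: eq_bigr => k _; rewrite lin_charM ?inE.
move/eqP; rewrite -subr_eq0 -{2}[\sum_k _]mul1r -mulrBl mulf_eq0 subr_eq0.
by rewrite (negPf xih) => /eqP.
Qed.

(** For abelian [H] the linear characters form a group of order [#|H|], to which Cauchy's theorem
    applies. *)
Lemma linear_char_of_prime_order (H : finGroupType) (p : nat) :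
    abelian [set: H] -> prime p -> (p %| #|[set: H]|)%N ->
  exists xi : 'CF([set: H]),
    [/\ xi \is a linear_char, xi != 1 & xi ^+ p = 1].
Proof.
move=> abH p_pr p_dv.
have [L [cF [cFinj cardL Lin _] [cF1 _ cFX _ _]]] := lin_char_group [set: H].
have [|u _ ou] := @Cauchy L p [set: L]%G p_pr.
  by rewrite cardsT cardL (derG1P abH) indexg1.
exists (cF u); split=> //.
  apply/eqP; rewrite -cF1 => /cFinj u1.
  by move: p_pr; rewrite -ou u1 order1.
by rewrite -cFX -ou expg_order cF1.
Qed.

Lemma cube_root1_add_sqr (t : algC) :
  t ^+ 3 = 1 -> exists z : int, t + t ^+ 2 = z%:~R.
Proof.
move=> t3.
have/eqP : (t - 1) * (t + t ^+ 2 + 1) = 0.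
  by rewrite -[RHS](subrr 1) -{3}t3; ring.
rewrite mulf_eq0 subr_eq0 addr_eq0 => /orP[]/eqP-> ; last by exists (-1).
by exists 2; rewrite expr1n.
Qed.

Section CubicCharacter.
Variables (H : finGroupType) (chi : 'CF([set: H])).
Hypotheses (Lchi : chi \is a linear_char) (chi3 : chi ^+ 3 = 1).

Lemma cubic_char_cube h : chi h ^+ 3 = 1.
Proof.
have := congr1 (fun xi : 'CF(_) => xi h) chi3.
by rewrite expS_cfunE // cfun1E inE.
Qed.

Lemma cubic_char_inv h : chi h^-1%g = chi h ^+ 2.
Proof.
have inv : chi h * chi h^-1%g = 1.
  by rewrite -lin_charM ?inE // mulgV lin_char1.
(* Insert [1 = chi h ^+ 3] and cancel one factor [chi h] against [chi h^-1]. *)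
by rewrite -[LHS]mul1r -(cubic_char_cube h) exprSr -mulrA inv mulr1.
Qed.

Lemma cubic_char_inverse_closed (D : {set H}) : inverse_closed D ->
  \sum_(d in D) chi d ^+ 2 = \sum_(d in D) chi d.
Proof.
move/(congr1 (char_eval chi)); rewrite char_eval_power char_eval_set => <-.
by apply: eq_bigr => d _; rewrite -cubic_char_inv.
Qed.

(** Twice the sum is the sum of the terms [chi d + chi d ^+ 2], each of which is 2 or -1. *)
Lemma cubic_char_inverse_closed_int (D : {set H}) : inverse_closed D ->
  exists z : int, 2 * \sum_(d in D) chi d = z%:~R.
Proof.
move=> invD; rewrite mulr_natl mulr2n -{2}(cubic_char_inverse_closed D) //.
rewrite -big_split /=.
apply: (big_ind (fun x : algC => exists z : int, x = z%:~R)).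
- by exists 0.
- by move=> x y [a ->] [b ->]; exists (a + b); rewrite intrD.
- by move=> d _; exact/cube_root1_add_sqr/cubic_char_cube.
Qed.

End CubicCharacter.

(* Here x and y stand for twice the values of the character on T0 and T1,
   which avoids having to show that the values themselves are integers. *)
Lemma doubled_char_values (n : nat) (x y : int) :
  x * y = -4 -> x * x + y * y = 8 * n%:Z - 2 * x - 2 * y -> n = 1%N.
Proof.
move=> xy sq.
(* [x] divides 4, so finitely many cases remain; only [x = 2] and [x = -2], with [y = -x], have a
   solution, and there [n = 1]. *)
have xle : (`|x| <= 4)%N.
  by apply: dvdn_leq => //; apply/dvdnP; exists `|y|%N; rewrite -abszM mulrC xy.
have : [|| x == -4, x == -3, x == -2, x == -1, x == 0, x == 1, x == 2, x == 3
         | x == 4] by lia.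
by do ![case/orP] => /eqP xE; move: xy sq; rewrite xE; nia.
Qed.

Theorem theorem3p5 (n : nat) (n_gt0 : (0 < n)%N) (n_mod6 : n = 4 %[mod 6])
    (n_gt2 : (2 < n)%N) (H : finGroupType) (abH : abelian [set: H])
    (cardH : #|[set: H]| = (n ^ 2 + n + 1)%N) :
  ~ exists T0 T1 : {set H},
      [/\ inverse_closed T0, inverse_closed T1, 1%g \in T0
        & (#|T0| + #|T1| = 2 * n + 1)%N]
      /\ T0%:GR * T1%:GR = [set: H]%:GR - gelt 1%g
      /\ T0%:GR ^+ 2 + T1%:GR ^+ 2
         = [set: H]%:GR *+ 2 - T0%:GR^(2) - T1%:GR^(2) + gelt 1%g *+ (2 * n).
Proof.
move=> [T0 [T1 [[inv0 inv1 _ _] [prod sumsq]]]].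
have dvd3 : (3 %| #|[set: H]|)%N.
  have [k nE] : exists k, n = (3 * k + 1)%N by exists (n %/ 3)%N; lia.
  (* With [n = 3k + 1], [n^2 + n + 1 = 9k^2 + 9k + 3]. *)
  by rewrite cardH nE; apply/dvdnP; exists (3 * k ^ 2 + 3 * k + 1)%N; lia.
have [chi [Lchi chi_neq1 chi3]] :=
  linear_char_of_prime_order H 3 abH isT dvd3.
have chiM : {morph chi : x y / (x * y)%g >-> x * y}.
  by move=> x y; rewrite lin_charM ?inE.
have chiH : char_eval chi [set: H]%:GR = 0.
  rewrite char_eval_set -[RHS](sum_linear_char H chi) //.
  by apply: eq_bigl => h; rewrite inE.
have chi1 : char_eval chi (gelt 1%g) = 1.
  by rewrite char_eval_elt lin_char1.
have chiT2 D : inverse_closed D ->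
    char_eval chi D%:GR^(2) = char_eval chi D%:GR.
  move=> invD; rewrite char_eval_power char_eval_set.
  rewrite -[RHS](cubic_char_inverse_closed H chi) //.
  by apply: eq_bigr => d _; rewrite /= lin_charX ?inE.
have [x xE] := cubic_char_inverse_closed_int H chi Lchi chi3 T0 inv0.
have [y yE] := cubic_char_inverse_closed_int H chi Lchi chi3 T1 inv1.
rewrite -char_eval_set in xE; rewrite -char_eval_set in yE.
move/(congr1 (char_eval chi)): prod.
rewrite raddfB /= char_evalM // chiH chi1 sub0r => prod.
move/(congr1 (char_eval chi)): sumsq.
rewrite !raddfD !raddfN !raddfMn /= !expr2 !char_evalM // !chiT2 // chiH chi1.
rewrite addr0 sub0r => sumsq.
suff n1 : n = 1%N by rewrite n1 in n_gt2.
(* Both integer equations are checked in [algC], where [x] and [y] become twice the character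
   values: the images of the two group ring equations, multiplied by 4. *)
apply: (doubled_char_values n x y); apply: (@intr_inj algC).
  by rewrite intrM -xE -yE mulrACA prod; ring.
rewrite !(intrB, intrD, intrM) /= -xE -yE -pmulrn.
set a := char_eval _ _ in sumsq *; set b := char_eval _ _ in sumsq *.
have -> : 2 * a * (2 * a) + 2 * b * (2 * b) = 4 * (a * a + b * b) by ring.
by rewrite sumsq; ring.
Qed.
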